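(* Let $n\ge 4$ be an integer and let $\Lambda_n$ denote the Lebesgue constant of Lagrange interpolation by polynomials of total degree at most $n$ at the equally spaced nodes of a triangle. Then $$\Lambda_n\le \Big(7+\mu_n\Big)\,\frac{2^{n+1}}{e\,n(\ln n-\ln 2)}\Big(1+\frac{15}{n-3}\Big),\qquad\text{where}\qquad \mu_n\le \frac{3e\,n(\ln n)^3}{2^{n/3}}+\frac{e\,n^2\ln n}{2^n}.$$ In particular $\mu_n\to 0$ as $n\to\infty$.
   Context: Let $\Delta\subset\mathbb{R}^2$ be a non-degenerate triangle; points of $\Delta$ are identified with their barycentric coordinates $\lambda=(\lambda_1,\lambda_2,\lambda_3)$, $\lambda_r\ge 0$, $\lambda_1+\lambda_2+\lambda_3=1$. For an integer $n\ge1$ let $I=\{i=(i_1,i_2,i_3)\in\mathbb{Z}_+^3: i_1+i_2+i_3=n\}$ and let the nodes be $a_i=(i_1/n,i_2/n,i_3/n)$, $i\in I$. The Lagrange fundamental polynomials $l_i$, $i\in I$, are the polynomials of total degree $\le n$ with $l_i(a_j)=\delta_{ij}$; explicitly $l_i(\lambda)=\prod_{s=1}^{3}\frac{1}{i_s!}\prod_{t=0}^{i_s-1}(n\lambda_s-t)$. The Lebesgue function is $\mathcal{L}_n(\lambda)=\sum_{i\in I}|l_i(\lambda)|$ and the Lebesgue constant is $\Lambda_n=\max_{\lambda\in\Delta}\mathcal{L}_n(\lambda)$, which equals the operator norm on $C(\Delta)$ of the map $f\mapsto \sum_{i\in I}f(a_i)l_i$. *)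

(* Defs.v *)
From HB Require Import structures.
From mathcomp Require Import all_boot all_order all_algebra.
From mathcomp Require Import all_classical all_reals all_analysis.
Set Implicit Arguments. Unset Strict Implicit. Unset Printing Implicit Defensive.
Import Order.TTheory GRing.Theory Num.Theory.
Local Open Scope classical_set_scope.
Local Open Scope ring_scope.

(* Points of the triangle in barycentric coordinates (l1, l2, l3). *)
Definition simplex {R : realType} : set (R * R * R) :=
  [set l | 0 <= l.1.1 /\ 0 <= l.1.2 /\ 0 <= l.2 /\ l.1.1 + l.1.2 + l.2 = 1].

Definition lfactor (R : realType) (n k : nat) (x : R) : R :=
  (k`!%:R)^-1 * \prod_(t < k) (n%:R * x - t%:R).

(* Lagrange fundamental polynomial l_i, i = (i1,i2,i3), i1+i2+i3 = n *)
Definition lagr (R : realType) (n i1 i2 i3 : nat) (l : R * R * R) : R :=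
  lfactor n i1 l.1.1 * lfactor n i2 l.1.2 * lfactor n i3 l.2.

Definition lebesgue_fun (R : realType) (n : nat) (l : R * R * R) : R :=
  \sum_(i1 < n.+1) \sum_(i2 < (n - i1).+1) `| lagr n i1 i2 (n - i1 - i2) l |.

Definition lebesgue_const (R : realType) (n : nat) : R :=
  sup [set lebesgue_fun n l | l in @simplex R].

Definition mu_bound (R : realType) (n : nat) : R :=
  3 * expR 1 * n%:R * (ln n%:R) ^+ 3 / ((2 : R) `^ (n%:R / 3))
  + expR 1 * n%:R ^+ 2 * ln n%:R / 2 ^+ n.

(* Main.v *)
Require Import Defs.
From HB Require Import structures.
From mathcomp Require Import all_boot all_order all_algebra.
From mathcomp Require Import all_classical all_reals all_analysis.
From mathcomp Require Import ring lra zify.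
Set Implicit Arguments. Unset Strict Implicit. Unset Printing Implicit Defensive.
Import Order.TTheory GRing.Theory Num.Theory.
Import numFieldNormedType.Exports.
Local Open Scope classical_set_scope.
Local Open Scope ring_scope.

(** Put [x = n l1], [y = n l2], [z = n l3]. The Lebesgue function is the
    coefficient of [t^n] in [A_x A_y A_z], where [A_x(t) = sum_k |C(x,k)| t^k].
    Write [x = p + u] with [p] a natural number and [u] in [0, 1); Vandermonde's
    identity bounds [A_x] coefficientwise by [(1 + t)^p A_u], and
    [A_u = 2 - (1 - t)^u]. Hence the Lebesgue function is at most the coefficient
    of [t^n] in [(1 + t)^(n - d) c(t)], where
    [c = (2 - (1-t)^u) (2 - (1-t)^v) (2 - (1-t)^w)] and [d = u + v + w] is 0, 1
    or 2; for [d = 0] it is at most 1. If [d = 1], expanding the product leaves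
    [s c_s <= 4 (b_s(u) + b_s(v) + b_s(w))] for [s >= 2], with
    [b_s(u) = u prod_(0 < t < s) (1 - u/t) <= min (u (1 - u), 1 / (e ln s))], and
    [n C(n-1, n-s) = s C(n, s)] turns the coefficient into [(2^n / n) E(s c_s)]
    for [s] binomial with parameters [n], [1/2]. The case [d = 2] is similar and
    gains a factor of nearly 2.
    For [n <= 34] the bound [4 sum b_s <= 8/3] suffices. For [n >= 35] the range
    [s >= n/3] contributes at most [12 / (e ln (n/3)) <= 14 / (e ln (n/2))],
    because [(n/2)^6 <= (n/3)^7], and the range [s < n/3] is exponentially
    small, so that it fits in the factor [1 + 15/(n-3)]. *)

(** * Formal power series *)

(* The alias keeps the Cauchy product apart from the pointwise product that
   [nat -> R] already carries. *)
Definition fps (R : Type) : Type := nat -> R.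

Section PowerSeriesRing.
Context {R : comNzRingType}.
Implicit Types f g h : fps R.

HB.instance Definition _ := GRing.Zmodule.copy (fps R) (nat -> R).

Lemma coef_fpsD f g n : (f + g) n = f n + g n.
Proof. by []. Qed.

Lemma coef_fpsB f g n : (f - g) n = f n - g n.
Proof. by []. Qed.

Definition fps_one : fps R := fun k => (k == 0)%:R.

Definition fps_mul f g : fps R := fun n => \sum_(i < n.+1) f i * g (n - i)%N.

Definition fps_trunc f n : {poly R} := \poly_(i < n) f i.

Lemma coef_fps_trunc_mul f g n k : (k < n)%N ->
  (fps_trunc f n * fps_trunc g n)`_k = fps_mul f g k.
Proof.
move=> ltkn; rewrite coefM; apply: eq_bigr => i _; rewrite !coef_poly.
by rewrite !ifT //; have := ltn_ord i; lia.
Qed.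

Lemma fps_mulC : commutative fps_mul.
Proof.
move=> f g; apply/funext => n.
by rewrite -!(@coef_fps_trunc_mul _ _ n.+1) // mulrC.
Qed.

Lemma fps_mulA : associative fps_mul.
Proof.
move=> f g h; apply/funext => n.
transitivity (fps_trunc f n.+1 * (fps_trunc g n.+1 * fps_trunc h n.+1))`_n.
  rewrite coefM; apply: eq_bigr => i _.
  by rewrite coef_poly ltn_ord coef_fps_trunc_mul // ltnS leq_subr.
rewrite mulrA coefM; apply: eq_bigr => i _.
by rewrite coef_fps_trunc_mul // coef_poly ltnS leq_subr.
Qed.

Lemma fps_mul1f : left_id fps_one fps_mul.
Proof.
move=> f; apply/funext => n; rewrite /fps_mul big_ord_recl mul1r subn0.
by rewrite big1 ?addr0 // => i _; rewrite mul0r.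
Qed.

Lemma fps_mulDl : left_distributive fps_mul +%R.
Proof.
move=> f g h; apply/funext => n; rewrite coef_fpsD -big_split.
by apply: eq_bigr => i _; rewrite mulrDl.
Qed.

Lemma fps_one_neq0 : fps_one != 0.
Proof. by apply/eqP => /(congr1 (@^~ 0%N))/eqP; rewrite oner_eq0. Qed.

HB.instance Definition _ := GRing.Zmodule_isComNzRing.Build (fps R)
  fps_mulA fps_mulC fps_mul1f fps_mulDl fps_one_neq0.

Lemma coef_fpsM f g n : (f * g) n = \sum_(i < n.+1) f i * g (n - i)%N.
Proof. by []. Qed.

Lemma coef_fps_natM m f n : (m%:R * f) n = m%:R * f n.
Proof.
elim: m => [|m IHm]; first by rewrite !mul0r.
by rewrite -!natr1 !mulrDl coef_fpsD IHm !mul1r.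
Qed.

Lemma coef_fps_nat m n : (m%:R : fps R) n = m%:R * (n == 0)%:R.
Proof. by rewrite -[m%:R in LHS]mulr1 coef_fps_natM. Qed.

End PowerSeriesRing.

Lemma ler_coef_fpsM {R : numDomainType} (f f' g g' : fps R) n :
  (forall k, 0 <= f k <= f' k) -> (forall k, 0 <= g k <= g' k) ->
  (f * g) n <= (f' * g') n.
Proof.
move=> ff' gg'; apply: ler_sum => i _.
by apply: ler_pM; case/andP: (ff' i); case/andP: (gg' (n - i)%N).
Qed.

Lemma coef_fpsM_ge0 {R : numDomainType} (f g : fps R) n :
  (forall k, 0 <= f k) -> (forall k, 0 <= g k) -> 0 <= (f * g) n.
Proof. by move=> f0 g0; apply: sumr_ge0 => i _; apply: mulr_ge0. Qed.

(** * The binomial series *)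

Section BinomialSeries.
Context {R : numFieldType}.
Implicit Types x y : R.

(* The coefficients of [(1 + t)^x]. *)
Definition gbin x : fps R := fun k => (k`!%:R)^-1 * \prod_(t < k) (x - t%:R).

(* The coefficients of [(1 - t)^x]. *)
Definition altbin x : fps R := fun k => (-1) ^+ k * gbin x k.

Definition absbin x : fps R := fun k => `|gbin x k|.

Lemma gbin0 x : gbin x 0 = 1.
Proof. by rewrite /gbin big_ord0 fact0 invr1 mulr1. Qed.

Lemma gbinS x k : k.+1%:R * gbin x k.+1 = (x - k%:R) * gbin x k.
Proof.
rewrite /gbin big_ord_recr /= factS natrM invfM.
have k1_neq0 : k.+1%:R != 0 :> R by rewrite pnatr_eq0.
have fact_neq0 : k`!%:R != 0 :> R by rewrite pnatr_eq0 -lt0n fact_gt0.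
by field; rewrite fact_neq0 addrC natr1 k1_neq0.
Qed.

Lemma gbin_nat m k : gbin m%:R k = 'C(m, k)%:R.
Proof.
elim: k => [|k IHk]; first by rewrite gbin0 bin0.
have k1_neq0 : k.+1%:R != 0 :> R by rewrite pnatr_eq0.
apply: (mulfI k1_neq0); rewrite gbinS IHk -natrM mul_bin_left natrM.
have [le_km|lt_mk] := leqP k m; first by rewrite natrB.
by rewrite bin_small // !mulr0.
Qed.

Lemma gbinD x y : gbin (x + y) = gbin x * gbin y.
Proof.
apply/funext; elim=> [|n IHn]; first by rewrite coef_fpsM big_ord1 !gbin0 mulr1.
have n1_neq0 : n.+1%:R != 0 :> R by rewrite pnatr_eq0.
apply: (mulfI n1_neq0); rewrite gbinS IHn.
transitivity (\sum_(i < n.+2) i%:R * gbin x i * gbin y (n.+1 - i)%N +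
              \sum_(i < n.+2) gbin x i * ((n.+1 - i)%:R * gbin y (n.+1 - i)%N));
    last first.
  rewrite coef_fpsM mulr_sumr -big_split; apply: eq_bigr => i _ /=.
  have -> : n.+1%:R = i%:R + (n.+1 - i)%:R :> R.
    by rewrite -natrD subnKC ?leq_ord.
  by ring.
symmetry; rewrite big_ord_recl /= !mul0r add0r.
rewrite [X in _ + X]big_ord_recr /= subnn mul0r mulr0 addr0 -big_split coef_fpsM mulr_sumr.
apply: eq_bigr => i _ /=; have le_in : (i <= n)%N by rewrite -ltnS.
by rewrite /bump /= add1n subSS gbinS (subSn le_in) gbinS natrB //; ring.
Qed.

Lemma altbin0 x : altbin x 0 = 1.
Proof. by rewrite /altbin gbin0 mulr1. Qed.

Lemma altbinS x k : k.+1%:R * altbin x k.+1 = (k%:R - x) * altbin x k.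
Proof. by rewrite /altbin mulrCA gbinS exprS; ring. Qed.

Lemma altbinD x y : altbin (x + y) = altbin x * altbin y.
Proof.
apply/funext => n; rewrite /altbin gbinD !coef_fpsM mulr_sumr.
apply: eq_bigr => i _.
have -> : (-1) ^+ n = (-1) ^+ i * (-1) ^+ (n - i) :> R.
  by rewrite -exprD subnKC ?leq_ord.
by ring.
Qed.

Lemma absbin0 : absbin 0 = 1.
Proof.
by apply/funext => k; rewrite /absbin -[0]/(0%:R) gbin_nat normr_nat bin0n.
Qed.

Lemma absbin_natD_le m x k : absbin (m%:R + x) k <= (gbin m%:R * absbin x) k.
Proof.
rewrite /absbin gbinD; apply: le_trans (ler_norm_sum _ _ _) _.
by apply: ler_sum => i _; rewrite normrM gbin_nat normr_nat.
Qed.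

Lemma absbin_natD_le3 (p q r n : nat) x y z :
  (absbin (p%:R + x) * absbin (q%:R + y) * absbin (r%:R + z)) n <=
  (gbin (p + q + r)%:R * (absbin x * absbin y * absbin z)) n.
Proof.
have absbin_itv m (t : R) k :
    0 <= absbin (m%:R + t) k <= (gbin m%:R * absbin t) k.
  by rewrite normr_ge0 absbin_natD_le.
have -> : gbin (p + q + r)%:R * (absbin x * absbin y * absbin z) =
    (gbin p%:R * absbin x) * (gbin q%:R * absbin y) * (gbin r%:R * absbin z).
  by rewrite !natrD !gbinD; ring.
apply: ler_coef_fpsM => // k; apply/andP; split; last exact: ler_coef_fpsM.
by apply: coef_fpsM_ge0 => j; apply: normr_ge0.
Qed.

End BinomialSeries.

Lemma lebesgue_funE {R : realType} (n : nat) (l : R * R * R) :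
  lebesgue_fun n l =
  (absbin (n%:R * l.1.1) * absbin (n%:R * l.1.2) * absbin (n%:R * l.2)) n.
Proof.
rewrite -mulrA coef_fpsM; apply: eq_bigr => i _.
rewrite coef_fpsM mulr_sumr; apply: eq_bigr => j _.
by rewrite /lagr 2!normrM -mulrA.
Qed.

(** * Derivative coefficients of [(1 - t)^x] *)

Section DerivativeCoefficients.
Context {R : numFieldType}.
Implicit Types x u v w : R.

(* The coefficient of [t^k] in [- t d/dt (1 - t)^x], for [k > 0]. *)
Definition dbin x (k : nat) : R := x * \prod_(1 <= t < k) (1 - x / t%:R).

Lemma dbin0 x : dbin x 0 = x.
Proof. by rewrite /dbin big_geq // mulr1. Qed.

Lemma dbin1 x : dbin x 1 = x.
Proof. by rewrite /dbin big_geq // mulr1. Qed.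

Lemma dbinS x k : (0 < k)%N -> dbin x k.+1 = dbin x k * (1 - x / k%:R).
Proof. by move=> k_gt0; rewrite /dbin big_nat_recr //= mulrA. Qed.

Lemma mulr_altbin x k : (0 < k)%N -> k%:R * altbin x k = - dbin x k.
Proof.
elim: k => // -[|k] IHk _; first by rewrite altbinS altbin0 dbin1 mulr1 sub0r.
have k1_neq0 : k.+1%:R != 0 :> R by rewrite pnatr_eq0.
by rewrite altbinS dbinS // -mulNr -IHk //; field; rewrite addrC natr1.
Qed.

Lemma onem_div_nat_itv x k : 0 <= x <= 1 -> 0 <= 1 - x / k%:R <= 1.
Proof.
move=> /andP[x_ge0 x_le1]; rewrite subr_ge0 gerBl divr_ge0 // andbT.
case: k => [|k]; first by rewrite invr0 mulr0.
by rewrite ler_pdivrMr ?ltr0n // mul1r (le_trans x_le1) // ler1n.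
Qed.

Lemma dbin_ge0 x k : 0 <= x <= 1 -> 0 <= dbin x k.
Proof.
move=> x01; apply: mulr_ge0; first by case/andP: x01.
by apply: prodr_ge0 => t _; case/andP: (onem_div_nat_itv t x01).
Qed.

Lemma dbin_nonincreasing x : 0 <= x <= 1 -> nonincreasing_seq (dbin x).
Proof.
move=> x01; apply/nonincreasing_seqP => -[|k]; first by rewrite dbin0 dbin1.
rewrite dbinS // ler_piMr ?dbin_ge0 //.
by case/andP: (onem_div_nat_itv k.+1 x01).
Qed.

Lemma dbin_le x k : 0 <= x <= 1 -> dbin x k <= x.
Proof.
by move=> x01; rewrite -[leRHS]dbin0; apply: dbin_nonincreasing.
Qed.

Lemma dbin_le_mulr_onem x k :
  0 <= x <= 1 -> (1 < k)%N -> dbin x k <= x * (1 - x).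
Proof.
move=> x01 k_gt1; have := dbin_nonincreasing x01 k_gt1.
by rewrite (dbinS x (ltn0Sn 0)) dbin1 divr1.
Qed.

Lemma dbin_one_eq0 k : (1 < k)%N -> dbin (1 : R) k = 0.
Proof.
move=> k_gt1; apply/eqP; rewrite eq_le dbin_ge0 ?ler01 ?lexx // andbT.
by rewrite (le_trans (dbin_le_mulr_onem _ _)) ?ler01 ?lexx // subrr mulr0.
Qed.

Lemma dbin1Dx x k :
  (0 < k)%N -> k%:R * dbin (1 + x) k.+1 = - ((1 + x) * dbin x k).
Proof.
elim: k => // -[|k] IHk _; first by rewrite dbinS // !dbin1 divr1; ring.
have k1_neq0 : k.+1%:R != 0 :> R by rewrite pnatr_eq0.
have factorE : k.+2%:R * (1 - (1 + x) / k.+2%:R) = k.+1%:R - x.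
  by rewrite mulrBr mulr1 mulrCA divff ?pnatr_eq0 // mulr1 -natr1; ring.
apply: (mulfI k1_neq0); rewrite [dbin _ k.+3]dbinS // [k.+2%:R * _]mulrCA.
by rewrite factorE mulrA IHk // [dbin x k.+2]dbinS //; field; rewrite addrC natr1.
Qed.

Lemma absbinE x : 0 <= x <= 1 -> absbin x = 2 - altbin x.
Proof.
move=> x01; apply/funext => k; rewrite coef_fpsB coef_fps_nat.
have -> : absbin x k = `|altbin x k|.
  by rewrite /altbin normrM normrX normrN1 expr1n mul1r.
case: k => [|k]; first by rewrite altbin0 normr1 /=; ring.
have k1_gt0 : 0 < k.+1%:R :> R by rewrite ltr0n.
rewrite mulr0 sub0r ler0_norm // -(pmulr_rle0 _ k1_gt0) mulr_altbin //.
by rewrite oppr_le0 dbin_ge0.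
Qed.

Lemma coef_absbin3 u v w s :
  0 <= u <= 1 -> 0 <= v <= 1 -> 0 <= w <= 1 -> (0 < s)%N ->
  s%:R * (absbin u * absbin v * absbin w) s =
  4 * (dbin u s + dbin v s + dbin w s)
  - 2 * (dbin (u + v) s + dbin (u + w) s + dbin (v + w) s)
  + dbin (u + v + w) s.
Proof.
move=> u01 v01 w01 s_gt0; rewrite !absbinE //.
have -> : (2 - altbin u) * (2 - altbin v) * (2 - altbin w) =
    8 - 4 * (altbin u + altbin v + altbin w)
    + 2 * (altbin (u + v) + altbin (u + w) + altbin (v + w))
    - altbin (u + v + w).
  by rewrite !altbinD; ring.
rewrite coef_fpsB coef_fpsD coef_fpsB !coef_fps_natM coef_fps_nat !coef_fpsD.
rewrite (gtn_eqF s_gt0).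
have dbinE x : dbin x s = - (s%:R * altbin x s) by rewrite mulr_altbin ?opprK.
by rewrite !dbinE /=; ring.
Qed.

End DerivativeCoefficients.

Section ThreeFactors.
Context {R : realFieldType}.
Implicit Types x u v w : R.

Lemma dbin_succ_itv x k : 1 <= x <= 2 -> (0 < k)%N ->
  - (2 * (x - 1)) <= k%:R * dbin x k.+1 <= 0.
Proof.
move=> x12 k_gt0; have x01 : 0 <= x - 1 <= 1 by lra.
have -> : x = 1 + (x - 1) by ring.
rewrite dbin1Dx // (_ : 1 + (x - 1) - 1 = x - 1); last by ring.
have := dbin_ge0 k x01; have := dbin_le k x01; nra.
Qed.

Lemma coef_absbin3_sum1 u v w s :
  0 <= u <= 1 -> 0 <= v <= 1 -> 0 <= w <= 1 ->
  u + v + w = 1 -> (1 < s)%N ->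
  s%:R * (absbin u * absbin v * absbin w) s <=
  4 * (dbin u s + dbin v s + dbin w s).
Proof.
move=> u01 v01 w01 sum1 s_gt1.
rewrite coef_absbin3 ?(ltnW s_gt1) // sum1 dbin_one_eq0 //.
have /(dbin_ge0 s) uv_ge0 : 0 <= u + v <= 1 by lra.
have /(dbin_ge0 s) uw_ge0 : 0 <= u + w <= 1 by lra.
have /(dbin_ge0 s) vw_ge0 : 0 <= v + w <= 1 by lra.
by lra.
Qed.

Lemma coef1_absbin3_sum1 u v w :
  0 <= u <= 1 -> 0 <= v <= 1 -> 0 <= w <= 1 ->
  u + v + w = 1 -> (absbin u * absbin v * absbin w) 1 = 1.
Proof.
move=> u01 v01 w01 sum1.
rewrite -[LHS]mul1r -[1 in X in X * _]/(1%:R) coef_absbin3 //.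
by rewrite !dbin1; lra.
Qed.

Lemma coef_absbin3_sum2 u v w s :
  0 <= u <= 1 -> 0 <= v <= 1 -> 0 <= w <= 1 ->
  u + v + w = 2 -> (0 < s)%N ->
  s.+1%:R * s%:R * (absbin u * absbin v * absbin w) s.+1 <=
  4 * s%:R * (dbin u s.+1 + dbin v s.+1 + dbin w s.+1) + 4.
Proof.
move=> u01 v01 w01 sum2 s_gt0; rewrite mulrAC coef_absbin3 // sum2.
have /dbin_succ_itv/(_ s_gt0) uv_itv : 1 <= u + v <= 2 by lra.
have /dbin_succ_itv/(_ s_gt0) uw_itv : 1 <= u + w <= 2 by lra.
have /dbin_succ_itv/(_ s_gt0) vw_itv : 1 <= v + w <= 2 by lra.
have /dbin_succ_itv/(_ s_gt0) two_itv : 1 <= (2 : R) <= 2 by lra.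
by lra.
Qed.

End ThreeFactors.

(** * Binomial sums *)

Lemma ffact_mul_bin (n k j : nat) : (k <= n)%N ->
  (n ^_ j * 'C(n - j, n - k) = k ^_ j * 'C(n, k))%N.
Proof.
move=> le_kn; elim: j => [|j IHj]; first by rewrite subn0 bin_sub.
rewrite !ffactnSr subnS -mulnA mul_bin_down mulnCA IHj mulnCA mulnA.
by congr (_ * _ * _)%N; lia.
Qed.

Lemma sqrn_le_expn2 (n : nat) : (n ^ 2 <= 4 * 2 ^ n)%N.
Proof.
elim: n => [//|n IHn]; have [n_le2|n_gt2] := leqP n 2.
  by case: n n_le2 {IHn} => [|[|[|]]].
by move: IHn; rewrite -!mulnn expnS; nia.
Qed.

Section BinomialSums.
Context {R : numFieldType}.
Implicit Types (f g : nat -> R) (x a : R).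

(* [2 ^ n] times the mean of [f] under the binomial law with parameters [n] and
   [1/2]. *)
Definition binomial_sum n f : R := \sum_(i < n.+1) f i * 'C(n, i)%:R.

Lemma ler_binomial_sum n f g : (forall i, (i <= n)%N -> f i <= g i) ->
  binomial_sum n f <= binomial_sum n g.
Proof.
by move=> le_fg; apply: ler_sum => i _; rewrite ler_wpM2r // le_fg // leq_ord.
Qed.

Lemma binomial_sumD n f g :
  binomial_sum n (fun i => f i + g i) = binomial_sum n f + binomial_sum n g.
Proof. by rewrite -big_split; apply: eq_bigr => i _; rewrite mulrDl. Qed.

Lemma binomial_sumZ n a f :
  binomial_sum n (fun i => a * f i) = a * binomial_sum n f.
Proof. by rewrite mulr_sumr; apply: eq_bigr => i _; rewrite mulrA. Qed.

Lemma binomial_sum_expr n x : binomial_sum n (fun i => x ^+ i) = (1 + x) ^+ n.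
Proof.
by rewrite exprDn; apply: eq_bigr => i _; rewrite expr1n mul1r mulr_natr.
Qed.

Lemma binomial_sum_cst n a : binomial_sum n (fun=> a) = a * 2 ^+ n.
Proof.
rewrite -[2]/(1 + 1) -binomial_sum_expr -binomial_sumZ.
by apply: eq_bigr => i _; rewrite expr1n mulr1.
Qed.

Lemma binomial_sum_natr n : binomial_sum n (fun i => i%:R) = n%:R / 2 * 2 ^+ n.
Proof.
case: n => [|n]; first by rewrite /binomial_sum big_ord1 !mul0r.
rewrite /binomial_sum big_ord_recl mul0r add0r.
under eq_bigr => i _ do rewrite -natrM -mul_bin_diag natrM -[X in _ * X]mul1r.
rewrite -mulr_sumr -/(binomial_sum n (fun=> 1)) binomial_sum_cst exprS.
by field.
Qed.

Lemma ffact_coef_gbinM n j (c : fps R) :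
  (n ^_ j)%:R * (gbin (n - j)%:R * c) n =
  binomial_sum n (fun i => (i ^_ j)%:R * c i).
Proof.
rewrite mulrC [_ * c]mulrC coef_fpsM mulr_suml; apply: eq_bigr => i _.
rewrite gbin_nat -[LHS]mulrA [in RHS]mulrAC [in RHS]mulrC; congr (_ * _).
by rewrite mulrC -!natrM ffact_mul_bin ?leq_ord.
Qed.

Lemma coef_gbin_pred_le n (c : fps R) (M T x : R) :
  (forall s, (s <= n)%N -> s%:R * c s <= M + T * x ^+ s) ->
  n%:R * (gbin (n - 1)%:R * c) n <= M * 2 ^+ n + T * (1 + x) ^+ n.
Proof.
move=> c_le; rewrite -[n in n%:R]ffactn1 ffact_coef_gbinM.
rewrite -binomial_sum_cst -binomial_sum_expr -binomial_sumZ -binomial_sumD.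
by apply: ler_binomial_sum => i le_in; rewrite ffactn1 c_le.
Qed.

Lemma coef_gbin_pred2_le n (c : fps R) (M T K x : R) :
  (1 < n)%N -> 0 <= T -> 0 <= x -> 0 <= M <= K -> 2 * K <= n%:R * M ->
  (forall s, (0 < s < n)%N ->
     s.+1%:R * s%:R * c s.+1 <= s%:R * (M + T * x ^+ s.+1) + K) ->
  n%:R * (gbin (n - 2)%:R * c) n <= M * 2 ^+ n + T * (1 + x) ^+ n.
Proof.
move=> n_gt1 T_ge0 x_ge0 /andP[M_ge0 le_MK] le_KM c_le.
have n1_gt0 : 0 < n.-1%:R :> R by rewrite ltr0n; lia.
have nE : n%:R = n.-1%:R + 1 :> R by rewrite natr1 prednK //; lia.
have ffactE k : k ^_ 2 = (k * k.-1)%N by rewrite ffactnS ffactn1.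
rewrite -(ler_pM2l n1_gt0) mulrA [_ * n%:R]mulrC -natrM -ffactE.
rewrite ffact_coef_gbinM.
have Tx_ge0 s : 0 <= n.-1%:R * T * x ^+ s.
  by rewrite !mulr_ge0 ?exprn_ge0 // ltW.
apply: le_trans (_ : binomial_sum n (fun i =>
  M * i%:R + (K - M) + n.-1%:R * T * x ^+ i) <= _).
  apply: ler_binomial_sum => -[|s] lt_sn; rewrite ffactE natrM /=.
    by rewrite !mul0r mulr0 add0r addr_ge0 ?subr_ge0.
  have -> : M * s.+1%:R + (K - M) = s%:R * M + K by rewrite -(natr1 s); ring.
  case: s lt_sn => [|s] lt_sn.
    by rewrite mulr0 !mul0r add0r addr_ge0 // (le_trans M_ge0).
  apply: le_trans (c_le _ _) _ => //.
  rewrite mulrDr addrAC lerD2l -[leRHS]mulrA.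
  apply: ler_wpM2r; first by rewrite mulr_ge0 ?exprn_ge0.
  by rewrite ler_nat; lia.
rewrite 2!binomial_sumD 2!binomial_sumZ binomial_sum_natr binomial_sum_cst.
rewrite binomial_sum_expr [leRHS]mulrDr [X in _ <= _ + X]mulrA lerD2r.
have -> : M * (n%:R / 2 * 2 ^+ n) + (K - M) * 2 ^+ n =
    (M * (n%:R / 2) + (K - M)) * 2 ^+ n by ring.
rewrite [leRHS]mulrA ler_wpM2r ?exprn_ge0 // -subr_ge0.
have -> : n.-1%:R * M - (M * (n%:R / 2) + (K - M)) = (n%:R * M - 2 * K) / 2.
  by rewrite nE; field.
by rewrite divr_ge0 // subr_ge0.
Qed.

End BinomialSums.

(** * Reduction to fractional parts *)

Section FractionalParts.
Context {R : realType}.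

Definition fracpart (x : R) : R := x - (Num.truncn x)%:R.

Lemma fracpart_itv (x : R) : 0 <= x -> 0 <= fracpart x < 1.
Proof.
move=> x_ge0; have := Num.Theory.truncn_itv x_ge0.
by rewrite /fracpart -natr1 => /andP[]; lra.
Qed.

Lemma fracpart_sum3 (n : nat) (x y z : R) :
  0 <= x -> 0 <= y -> 0 <= z -> x + y + z = n%:R ->
  exists2 d : nat, (d < 3)%N & fracpart x + fracpart y + fracpart z = d%:R /\
    (Num.truncn x + Num.truncn y + Num.truncn z)%N = (n - d)%N.
Proof.
move=> /fracpart_itv x_itv /fracpart_itv y_itv /fracpart_itv z_itv sumE.
set N := (_ + _ + Num.truncn z)%N.
have sum_frac : fracpart x + fracpart y + fracpart z = n%:R - N%:R.
  by rewrite -sumE !natrD /fracpart; ring.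
have le_Nn : (N <= n)%N by rewrite -(ler_nat R); lra.
have lt_nN : (n < N + 3)%N by rewrite -(ltr_nat R) natrD; lra.
by exists (n - N)%N; [lia|split; [rewrite natrB|lia]].
Qed.

Lemma lebesgue_fun_le_coef (n : nat) (l : R * R * R) : simplex l ->
  exists (d : nat) (u v w : R),
  [/\ (d < 3)%N, [/\ 0 <= u <= 1, 0 <= v <= 1 & 0 <= w <= 1],
      u + v + w = d%:R &
      lebesgue_fun n l <=
        (gbin (n - d)%:R * (absbin u * absbin v * absbin w)) n].
Proof.
move=> [l1_ge0 [l2_ge0 [l3_ge0 suml]]].
have mul_n_ge0 (t : R) : 0 <= t -> 0 <= n%:R * t by move=> ?; rewrite mulr_ge0.
have := @fracpart_sum3 n _ _ _
  (mul_n_ge0 _ l1_ge0) (mul_n_ge0 _ l2_ge0) (mul_n_ge0 _ l3_ge0).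
rewrite -!mulrDr suml mulr1 => -[//|d lt_d3 [sum_frac sum_trunc]].
have itv (t : R) : 0 <= t -> 0 <= fracpart (n%:R * t) <= 1.
  by move=> /mul_n_ge0/fracpart_itv/andP[-> /ltW].
exists d, (fracpart (n%:R * l.1.1)), (fracpart (n%:R * l.1.2)),
  (fracpart (n%:R * l.2)); split=> //; first by split; apply: itv.
have natD_frac (t : R) : t = (Num.truncn t)%:R + fracpart t.
  by rewrite addrC subrK.
rewrite lebesgue_funE [X in absbin X * _ * _]natD_frac.
rewrite [X in _ * absbin X * _]natD_frac [X in _ * absbin X]natD_frac.
by rewrite -sum_trunc absbin_natD_le3.
Qed.

End FractionalParts.

(** * Logarithmic decay of the coefficients *)

Section LogarithmicDecay.
Context {R : realType}.
Implicit Types a x : R.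

Lemma exprn_le_expR n x : (0 < n)%N -> 0 <= 1 + x / n%:R ->
  (1 + x / n%:R) ^+ n <= expR x.
Proof.
move=> n_gt0 base_ge0; have n_neq0 : n%:R != 0 :> R by rewrite pnatr_eq0 -lt0n.
rewrite -[x in expR x](divfK n_neq0) [_ / _ * _]mulrC expRM_natl.
by rewrite lerXn2r ?nnegrE ?expR_ge0 // expR_ge1Dx.
Qed.

Lemma ln_le_tangent a x : 0 < a -> 0 < x -> ln x <= ln a + (x / a - 1).
Proof.
move=> a_gt0 x_gt0; have xa_gt0 : 0 < x / a by rewrite divr_gt0.
have : ln (1 + (x / a - 1)) <= x / a - 1 by apply: le_ln1Dx; lra.
by rewrite addrC subrK ln_div ?posrE //; lra.
Qed.

Lemma mulr_expRN_le x : x * expR (- x) <= (expR 1)^-1.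
Proof.
rewrite expRN ler_pdivrMr ?expR_gt0 // mulrC -expRB.
by have := expR_ge1Dx (x - 1); rewrite addrC subrK.
Qed.

Lemma dbin_le_expR x k :
  0 <= x <= 1 -> dbin x k <= x * expR (- (x * ln k%:R)).
Proof.
move=> x01; have /andP[x_ge0 x_le1] := x01.
elim: k => [|[|k] IHk].
- by rewrite dbin0 ln0 // mulr0 oppr0 expR0 mulr1.
- by rewrite dbin1 ln1 mulr0 oppr0 expR0 mulr1.
have k1_gt0 : 0 < k.+1%:R :> R by rewrite ltr0n.
have lnS_le : ln k.+2%:R <= ln k.+1%:R + k.+1%:R^-1 :> R.
  apply: le_trans (ln_le_tangent k1_gt0 _) _; first by rewrite ltr0n.
  by rewrite -(natr1 k.+1) mulrDl divff ?gt_eqF // mul1r [1 + _]addrC addrK.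
rewrite dbinS //.
apply: (@le_trans _ _
  (x * expR (- (x * ln k.+1%:R)) * expR (- (x / k.+1%:R)))).
  apply: ler_pM => //; first exact: dbin_ge0.
    by case/andP: (onem_div_nat_itv k.+1 x01).
  exact: expR_ge1Dx.
rewrite -mulrA -expRD ler_wpM2l // ler_expR -opprD lerN2 -mulrDr.
by rewrite ler_wpM2l.
Qed.

Lemma dbin_le_ln x k :
  0 <= x <= 1 -> (1 < k)%N -> dbin x k <= (expR 1 * ln k%:R)^-1.
Proof.
move=> x01 k_gt1; apply: le_trans (dbin_le_expR _ x01) _.
have lnk_gt0 : 0 < ln k%:R :> R by rewrite ln_gt0 // ltr1n.
by rewrite invfM ler_pdivlMr // mulrAC; exact: mulr_expRN_le.
Qed.

End LogarithmicDecay.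

(** * Majorants of the Lebesgue function *)

Section Majorants.
Context {R : realType}.

Definition dbin3_majorant (g : nat -> R) : Prop := forall (u v w : R) (s : nat),
  0 <= u <= 1 -> 0 <= v <= 1 -> 0 <= w <= 1 ->
  u + v + w = 1 \/ u + v + w = 2 -> (1 < s)%N ->
  4 * (dbin u s + dbin v s + dbin w s) <= g s.

Lemma dbin3_majorant_cst : dbin3_majorant (fun=> 8 / 3).
Proof.
move=> u v w s u01 v01 w01 sumE s_gt1.
have u_le := dbin_le_mulr_onem u01 s_gt1.
have v_le := dbin_le_mulr_onem v01 s_gt1.
have w_le := dbin_le_mulr_onem w01 s_gt1.
suff : u * (1 - u) + v * (1 - v) + w * (1 - w) <= 2 / 3 by lra.
have : 0 <= (u - v) ^+ 2 + (u - w) ^+ 2 + (v - w) ^+ 2.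
  by rewrite !addr_ge0 // sqr_ge0.
case: sumE => sumE; have -> : w = (u + v + w) - u - v by [ring];
  rewrite sumE; nra.
Qed.

Lemma dbin3_majorant_ln (y : R) : 1 < y ->
  dbin3_majorant
    (fun s => 12 / (expR 1 * ln y) + 8 / 3 * 2 `^ y * 2^-1 ^+ s).
Proof.
move=> y_gt1 u v w s u01 v01 w01 sumE s_gt1.
have lny_gt0 : 0 < ln y by rewrite ln_gt0.
have elny_gt0 : 0 < expR 1 * ln y by rewrite mulr_gt0 ?expR_gt0.
have [le_ys|lt_sy] := lerP y s%:R.
  have lns_ge : ln y <= ln s%:R by rewrite ler_ln ?posrE; lra.
  have inv_lns_le : (expR 1 * ln s%:R)^-1 <= (expR 1 * ln y)^-1.
    rewrite lef_pV2 ?posrE ?ler_wpM2l ?mulr_gt0 ?expR_ge0 ?expR_gt0 //.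
    exact: lt_le_trans lns_ge.
  have tail_ge0 : 0 <= 8 / 3 * 2 `^ y * 2^-1 ^+ s :> R.
    by rewrite !mulr_ge0 ?powR_ge0 ?exprn_ge0 ?invr_ge0.
  have := dbin_le_ln u01 s_gt1; have := dbin_le_ln v01 s_gt1.
  by have := dbin_le_ln w01 s_gt1; lra.
apply: le_trans (dbin3_majorant_cst u01 v01 w01 sumE s_gt1) _.
rewrite -[leLHS]add0r lerD ?divr_ge0 ?(ltW elny_gt0) //.
rewrite -mulrA ler_peMr ?divr_ge0 // exprVn ler_pdivlMr ?exprn_gt0 // mul1r.
by rewrite -powR_mulrn // ler_powR ?ler1n // ltW.
Qed.

Lemma lebesgue_fun_le_majorant (n : nat) (M T x : R) (l : R * R * R) :
  (1 < n)%N -> 0 <= T -> 0 <= x -> 8 / n%:R <= M <= 4 -> 1 <= M + T * x ->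
  dbin3_majorant (fun s => M + T * x ^+ s) -> simplex l ->
  n%:R * lebesgue_fun n l <= M * 2 ^+ n + T * (1 + x) ^+ n.
Proof.
move=> n_gt1 T_ge0 x_ge0 /andP[M_ge M_le4] MTx_ge1 major sl.
have n_gt0 : 0 < n%:R :> R by rewrite ltr0n; lia.
have M_ge0 : 0 <= M by apply: le_trans M_ge; rewrite divr_ge0 // ltW.
have nM_ge8 : 8 <= n%:R * M by rewrite mulrC -ler_pdivrMr.
have [d [u [v [w [lt_d3 [u01 v01 w01] sumE]]]]] := lebesgue_fun_le_coef n sl.
move=> /(ler_wpM2l (ltW n_gt0))/le_trans; apply.
case: d lt_d3 sumE => [|[|[|//]]] _ sumE.
- have [-> -> ->] : [/\ u = 0, v = 0 & w = 0] by split; lra.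
  rewrite absbin0 subn0 !mulr1 gbin_nat binn mulr1 -[leLHS]addr0.
  apply: lerD; last by rewrite mulr_ge0 // exprn_ge0 // addr_ge0.
  rewrite -(ler_pM2l n_gt0) mulrA.
  apply: (@le_trans _ _ (8 * 2 ^+ n)); last by rewrite ler_wpM2r // exprn_ge0.
  rewrite -natrX -!natrM ler_nat mulnn (leq_trans (sqrn_le_expn2 n)) //.
  by rewrite leq_mul2r orbT.
- apply: coef_gbin_pred_le => -[|[|s]] le_sn.
  + by rewrite mul0r addr_ge0 // mulr_ge0 ?exprn_ge0.
  + by rewrite mul1r coef1_absbin3_sum1.
  + apply: le_trans (coef_absbin3_sum1 _ _ _ _ _) _ => //.
    by apply: major => //; left.
- apply: (@coef_gbin_pred2_le _ _ _ _ _ 4) => //.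
  + by rewrite M_ge0.
  + by rewrite (le_trans _ nM_ge8) //; lra.
  move=> s /andP[s_gt0 lt_sn].
  apply: le_trans (coef_absbin3_sum2 _ _ _ _ _) _ => //.
  rewrite lerD2r mulrAC mulrC ler_wpM2l //.
  by apply: major => //; right.
Qed.

End Majorants.

(** * Numerical estimates *)

Section NumericalEstimates.
Context {R : realType}.
Implicit Types x : R.

Lemma expR1_ge : 2707 / 1000 <= expR 1 :> R.
Proof.
have /(le_trans _) : (1 + 1 / 128) ^+ 128 <= expR 1 :> R.
  by apply: exprn_le_expR => //; lra.
by apply; lra.
Qed.

Lemma expR1_le : expR 1 <= 273 / 100 :> R.
Proof.
have bound_gt0 : 0 < 273 / 100 :> R by lra.
rewrite -[leLHS]invrK -expRN (invf_ple (expR_gt0 _) bound_gt0).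
have /(le_trans _) : (1 + - 1 / 128) ^+ 128 <= expR (- 1) :> R.
  by apply: exprn_le_expR => //; lra.
by apply; lra.
Qed.

(* The tangent of [ln] at [e ^ 3], with [e] replaced by rational bounds. *)
Lemma expR1_ln_le x : 0 < x -> expR 1 * ln x <= 546 / 100 + x / (73 / 10).
Proof.
move=> x_gt0; have e_gt0 := @expR_gt0 R 1.
have e3_gt0 : 0 < expR 1 ^+ 3 :> R by rewrite exprn_gt0.
have e2_ge : 73 / 10 <= expR 1 ^+ 2 :> R by have := expR1_ge; nra.
have := ler_wpM2l (ltW e_gt0) (ln_le_tangent e3_gt0 x_gt0).
rewrite lnXn // expRK => /le_trans; apply.
have -> : expR 1 * (1 *+ 3 + (x / expR 1 ^+ 3 - 1)) =
    2 * expR 1 + x / expR 1 ^+ 2 by field; rewrite gt_eqF.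
apply: lerD; first by have := expR1_le; lra.
by rewrite ler_wpM2l ?lef_pV2 ?posrE ?(ltW x_gt0) ?exprn_gt0 //; lra.
Qed.

Lemma const_majorant_estimate x : 4 <= x <= 34 ->
  8 / 3 * (expR 1 * ln (x / 2)) * (x - 3) <= 14 * (x + 12).
Proof.
move=> /andP[x_ge4 x_le34].
have [half_gt0 xB3_ge0] : 0 < x / 2 /\ 0 <= x - 3 by lra.
have := ler_wpM2r xB3_ge0 (expR1_ln_le half_gt0).
have : 0 <= (x - 4) * (34 - x) by apply: mulr_ge0; lra.
lra.
Qed.

Lemma ln_half_le_ln_third x : 35 <= x -> 6 * ln (x / 2) <= 7 * ln (x / 3).
Proof.
move=> x_ge35; have [half_gt0 third_gt0] : 0 < x / 2 /\ 0 < x / 3 by lra.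
rewrite mulr_natl -lnXn // mulr_natl -lnXn // ler_ln ?posrE ?exprn_gt0 //.
have -> : (x / 3) ^+ 7 = x ^+ 6 * (x / 2187) by field.
have -> : (x / 2) ^+ 6 = x ^+ 6 * (1 / 64) by field.
by rewrite ler_wpM2l ?exprn_ge0 //; lra.
Qed.

Lemma ln_third_ge2 x : 35 <= x -> 2 <= ln (x / 3).
Proof.
move=> x_ge35; rewrite -[2](@expRK R) ler_ln ?posrE ?expR_gt0 //; last by lra.
rewrite -[2]mulr1 expRM_natl; have := @expR1_le; have := @expR1_ge; nra.
Qed.

Lemma tail_factor_le x : 35 <= x ->
  8 / 3 * (expR 1 * ln (x / 2)) * (x - 3) <= 210 * (1 + 5 * x / 384) ^+ 4.
Proof.
move=> x_ge35; have [half_gt0 xB3_ge0] : 0 < x / 2 /\ 0 <= x - 3 by lra.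
have := ler_wpM2r xB3_ge0 (expR1_ln_le half_gt0).
set z := 1 + 5 * x / 384.
have z4_ge : 52 / 10 * z ^+ 2 - 676 / 100 <= z ^+ 4.
  by have := sqr_ge0 (z ^+ 2 - 26 / 10); lra.
rewrite /z in z4_ge *; nra.
Qed.

(* Up to the power [n / 3] the two sides compare [2 (3/2)^3] to [2^3], and
   [2 (3/2)^3 / 2^3 = 1 - 5/32 <= exp (- 5/32)]. *)
Lemma tail_decay n :
  2 `^ (n%:R / 3) * (1 + 2^-1) ^+ n <= 2 ^+ n / (1 + 5 * n%:R / 384) ^+ 4 :> R.
Proof.
have base_gt0 : 0 < 1 + 5 * n%:R / 384 :> R by have := ler0n R n; lra.
rewrite ler_pdivlMr ?exprn_gt0 //.
have bernoulli : (1 + 5 * n%:R / 384) ^+ 4 <= expR (5 * n%:R / 96) :> R.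
  have -> : 5 * n%:R / 384 = 5 * n%:R / 96 / 4 :> R by field.
  by apply: exprn_le_expR => //; have := ler0n R n; lra.
have three_halves_gt0 : 0 < 1 + 2^-1 :> R by lra.
have ln_rate : ln 2 + 3 * ln (1 + 2^-1) + 5 / 32 <= 3 * ln 2 :> R.
  have : ln (1 + (- (5 / 32))) <= - (5 / 32) :> R by apply: le_ln1Dx; lra.
  have -> : 1 + (- (5 / 32)) = 2 * (1 + 2^-1) ^+ 3 / 2 ^+ 3 :> R by field.
  by rewrite ln_div ?lnM ?lnXn ?posrE ?mulr_gt0 ?exprn_gt0 //; lra.
apply: le_trans (ler_wpM2l _ bernoulli) _.
  by rewrite mulr_ge0 ?powR_ge0 // exprn_ge0.
have exprE (a : R) : 0 < a -> a ^+ n = expR (n%:R * ln a).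
  by move=> a_gt0; rewrite expRM_natl lnK ?posrE.
rewrite /powR pnatr_eq0 /= !exprE //.
rewrite -!expRD ler_expR.
by have := ler_wpM2l (ler0n R n) ln_rate; lra.
Qed.

Lemma ln_majorant_estimate x : 35 <= x ->
  (12 / (expR 1 * ln (x / 3)) + 8 / 3 / (1 + 5 * x / 384) ^+ 4)
    * (expR 1 * ln (x / 2)) * (x - 3) <= 14 * (x + 12).
Proof.
move=> x_ge35; have ln_third_ge := ln_third_ge2 x_ge35.
have xB3_gt0 : 0 < x - 3 by lra.
have base_gt0 : 0 < (1 + 5 * x / 384) ^+ 4 by apply: exprn_gt0; lra.
have head_le : 12 / (expR 1 * ln (x / 3)) * (expR 1 * ln (x / 2)) <= 14.
  have -> : 12 / (expR 1 * ln (x / 3)) * (expR 1 * ln (x / 2)) =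
      12 * ln (x / 2) / ln (x / 3).
    by field; rewrite !gt_eqF ?expR_gt0 //; lra.
  by rewrite ler_pdivrMr; have := ln_half_le_ln_third x_ge35; lra.
have tail_le : 8 / 3 / (1 + 5 * x / 384) ^+ 4 * (expR 1 * ln (x / 2)) * (x - 3)
    <= 210.
  by rewrite 2!(mulrAC _ _^-1) ler_pdivrMr // tail_factor_le.
by have := ler_wpM2r (ltW xB3_gt0) head_le; lra.
Qed.

End NumericalEstimates.

(** * The Lebesgue constant *)

Section LebesgueConstant.
Context {R : realType}.
Implicit Types (n : nat) (l : R * R * R).

Lemma lebesgue_fun_le_const_majorant n l : (4 <= n)%N -> simplex l ->
  n%:R * lebesgue_fun n l <= 8 / 3 * 2 ^+ n.
Proof.
move=> n_ge4 sl; have nR_ge4 : 4 <= n%:R :> R by rewrite ler_nat.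
have := @lebesgue_fun_le_majorant R n (8 / 3) 0 0 l.
rewrite !(mul0r, mulr0, addr0); apply=> //; last 1 first.
- move=> u v w s u01 v01 w01 sumE s_gt1.
  by rewrite mul0r addr0 (dbin3_majorant_cst _ _ _ _ s_gt1).
- by lia.
- by rewrite ler_pdivrMr; [apply/andP; split; lra|lra].
- by lra.
Qed.

Lemma lebesgue_fun_le_ln_majorant n l : (35 <= n)%N -> simplex l ->
  n%:R * lebesgue_fun n l <=
  (12 / (expR 1 * ln (n%:R / 3)) + 8 / 3 / (1 + 5 * n%:R / 384) ^+ 4) * 2 ^+ n.
Proof.
move=> n_ge35 sl; have nR_ge35 : 35 <= n%:R :> R by rewrite ler_nat.
have ln_third_ge := ln_third_ge2 nR_ge35.
have eln_ge5 : 5 <= expR 1 * ln (n%:R / 3) :> R.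
  by apply: le_trans (ler_pM _ _ expR1_ge ln_third_ge); lra.
have nR_gt0 : 0 < n%:R :> R by lra.
have eln_gt0 : 0 < expR 1 * ln (n%:R / 3) :> R by lra.
have pow_ge1 : 1 <= 2 `^ (n%:R / 3) :> R.
  by rewrite -[leLHS](powRr0 2) ler_powR ?ler1n //; lra.
have head_gt0 : 0 < 12 / (expR 1 * ln (n%:R / 3)) :> R by rewrite divr_gt0.
have head_le4 : 12 / (expR 1 * ln (n%:R / 3)) <= 4 :> R.
  by rewrite ler_pdivrMr //; lra.
have head_ge : 8 / n%:R <= 12 / (expR 1 * ln (n%:R / 3)) :> R.
  have third_gt0 : 0 < n%:R / 3 :> R by lra.
  rewrite ler_pdivrMr // mulrAC ler_pdivlMr //.
  by have := expR1_ln_le third_gt0; lra.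
have third_gt1 : 1 < n%:R / 3 :> R by lra.
have major := dbin3_majorant_ln third_gt1.
apply: le_trans (lebesgue_fun_le_majorant _ _ _ _ _ major sl) _ => //.
- exact: leq_trans n_ge35.
- by rewrite head_ge.
- by lra.
rewrite [leRHS]mulrDl lerD2l -[leLHS]mulrA [leRHS]mulrAC -[leRHS]mulrA.
by rewrite ler_wpM2l // tail_decay.
Qed.

Lemma lebesgue_fun_le n l : (4 <= n)%N -> simplex l ->
  lebesgue_fun n l <=
    7 * (2 ^+ n.+1 / (expR 1 * n%:R * (ln n%:R - ln 2))) * (1 + 15 / (n%:R - 3)).
Proof.
move=> n_ge4 sl; have nR_ge4 : 4 <= n%:R :> R by rewrite ler_nat.
have ln_half_gt0 : 0 < ln (n%:R / 2) :> R by rewrite ln_gt0 //; lra.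
have n_gt0 : 0 < n%:R :> R by lra.
have nB3_gt0 : 0 < n%:R - 3 :> R by lra.
have eln_gt0 : 0 < expR 1 * ln (n%:R / 2) * (n%:R - 3) :> R.
  by rewrite !mulr_gt0 ?expR_gt0.
have [K le_K K_le] : exists2 K : R, n%:R * lebesgue_fun n l <= K * 2 ^+ n &
    K * (expR 1 * ln (n%:R / 2)) * (n%:R - 3) <= 14 * (n%:R + 12).
  have [n_le34|n_ge35] := leqP n 34.
    exists (8 / 3); first exact: lebesgue_fun_le_const_majorant.
    by apply: const_majorant_estimate; rewrite !ler_nat n_ge4.
  eexists; first exact: lebesgue_fun_le_ln_majorant.
  by apply: ln_majorant_estimate; rewrite ler_nat.
rewrite -ln_div ?posrE //.
have -> : 7 * (2 ^+ n.+1 / (expR 1 * n%:R * ln (n%:R / 2))) *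
    (1 + 15 / (n%:R - 3)) = 14 * (n%:R + 12) * 2 ^+ n
    / (expR 1 * ln (n%:R / 2) * (n%:R - 3)) / n%:R :> R.
  by rewrite exprS; field; rewrite !gt_eqF ?expR_gt0.
rewrite ler_pdivlMr // mulrC; apply: le_trans le_K _.
by rewrite ler_pdivlMr // mulrAC ler_wpM2r ?exprn_ge0 // mulrA.
Qed.

Lemma mu_bound_ge0 n : 0 <= mu_bound R n.
Proof.
have ln_ge0 : 0 <= ln n%:R :> R.
  by case: n => [|n]; [rewrite ln0|rewrite ln_ge0 // ler1n].
by rewrite /mu_bound addr_ge0 // divr_ge0 ?powR_ge0 ?exprn_ge0 //;
  rewrite !mulr_ge0 ?expR_ge0 ?exprn_ge0.
Qed.

Lemma lebesgue_const_le n (B : R) :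
  (forall l, simplex l -> lebesgue_fun n l <= B) -> lebesgue_const R n <= B.
Proof.
move=> le_B; apply: ge_sup => [|_ [l sl <-]]; last exact: le_B.
exists (lebesgue_fun n (1, 0, 0)), (1, 0, 0) => //.
by rewrite /simplex /= !addr0; do !split.
Qed.

Lemma cvg_exprn_div_expR (k : nat) (c : R) : 0 < c ->
  n%:R ^+ k / expR (n%:R * c) @[n --> \oo] --> (0 : R).
Proof.
move=> c_gt0; set C : R := k.+1`!%:R / c ^+ k.+1.
have natV_cvg0 : n%:R^-1 @[n --> \oo] --> (0 : R).
  apply/gtr0_cvgV0; last exact: cvgr_idn.
  by near=> n; rewrite ltr0n; near: n; exact: nbhs_infty_gt.
apply: (@squeeze_cvgr _ _ _ _ (fun=> 0) (fun n => C * n%:R^-1)); last 2 first.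
- exact: cvg_cst.
- by rewrite -[X in _ --> X](mulr0 C); apply: cvgM => //; exact: cvg_cst.
near=> n; rewrite divr_ge0 ?exprn_ge0 ?expR_ge0 //=.
have n_gt0 : 0 < n%:R :> R by rewrite ltr0n; near: n; exact: nbhs_infty_gt.
have : (n%:R * c) ^+ k.+1 / k.+1`!%:R <= expR (n%:R * c).
  apply: le_trans (expR_ge1Dxn k _); first by rewrite lerDr.
  by rewrite mulr_ge0 // ltW.
rewrite ler_pdivrMr ?ltr0n ?fact_gt0 // => taylor_ge.
rewrite ler_pdivrMr ?expR_gt0 // mulrAC ler_pdivlMr //.
rewrite /C mulrAC ler_pdivlMr ?exprn_gt0 //.
by rewrite -exprSr -exprMn [leRHS]mulrC.
Unshelve. all: by end_near. Qed.

Lemma mu_bound_cvg0 : mu_bound R n @[n --> \oo] --> (0 : R).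
Proof.
have ln2_gt0 : 0 < ln 2 :> R by rewrite ln_gt0 // ltr1n.
pose majorant n : R :=
  3 * expR 1 * (n%:R ^+ 4 / expR (n%:R * (ln 2 / 3)))
  + expR 1 * (n%:R ^+ 3 / expR (n%:R * ln 2)).
have scaled_cvg0 (a c : R) k : 0 < c ->
    a * (n%:R ^+ k / expR (n%:R * c)) @[n --> \oo] --> (0 : R).
  move=> c_gt0; rewrite -[X in _ --> X](mulr0 a).
  by apply: cvgM; [exact: cvg_cst|exact: cvg_exprn_div_expR].
have majorant_cvg0 : majorant n @[n --> \oo] --> (0 : R).
  rewrite -[X in _ --> X](addr0 0).
  by apply: cvgD; apply: scaled_cvg0; rewrite ?divr_gt0.
apply: squeeze_cvgr (cvg_cst 0) majorant_cvg0.
near=> n; rewrite mu_bound_ge0 /=.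
have n_gt0 : (0 < n)%N by near: n; exact: nbhs_infty_gt.
have lnn_ge0 : 0 <= ln n%:R :> R by rewrite ln_ge0 // ler1n.
have lnn_le : ln n%:R <= n%:R :> R by rewrite ltW // ln_sublinear // ltr0n.
have powE : 2 `^ (n%:R / 3) = expR (n%:R * (ln 2 / 3)) :> R.
  by rewrite /powR pnatr_eq0 /= mulrAC mulrA.
have expE : 2 ^+ n = expR (n%:R * ln 2) :> R by rewrite expRM_natl lnK ?posrE.
have invE_ge0 (c : R) : 0 <= (expR c)^-1 by rewrite invr_ge0 expR_ge0.
rewrite /mu_bound /majorant powE expE; apply: lerD.
- rewrite -!(mulrA (3 * expR 1)) ler_wpM2l ?mulr_ge0 ?expR_ge0 //.
  by rewrite ler_wpM2r // (exprS _ 3) ler_wpM2l // lerXn2r ?nnegrE.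
- rewrite -!(mulrA (expR 1)) ler_wpM2l ?expR_ge0 //.
  by rewrite ler_wpM2r // (exprSr _ 2) ler_wpM2l // exprn_ge0.
Unshelve. all: by end_near. Qed.

End LebesgueConstant.

Theorem theorem2 (R : realType) :
  (forall n : nat, (4 <= n)%N ->
     lebesgue_const R n <=
       (7 + mu_bound R n) * (2 ^+ n.+1 / (expR 1 * n%:R * (ln n%:R - ln 2)))
       * (1 + 15 / (n%:R - 3))) /\
  (mu_bound R n @[n --> \oo] --> (0 : R)).
Proof.
split=> [n n_ge4|]; last exact: mu_bound_cvg0.
apply: lebesgue_const_le => l sl; apply: le_trans (lebesgue_fun_le n_ge4 sl) _.
have nR_ge4 : 4 <= n%:R :> R by rewrite ler_nat.
have lnB_ge0 : 0 <= ln n%:R - ln 2 :> R.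
  by rewrite subr_ge0 ler_ln ?posrE //; lra.
apply: ler_wpM2r; first by rewrite addr_ge0 // divr_ge0 //; lra.
apply: ler_wpM2r; last by rewrite lerDl mu_bound_ge0.
by rewrite divr_ge0 ?exprn_ge0 // !mulr_ge0 ?expR_ge0.
Qed.
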